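(* Let $E$ be a Banach space, let $0<\lambda\le1$, and let $u:E\to C_\lambda[0,1]$ be a bounded linear operator into the Hölder space $C_\lambda[0,1]$. Then for all $k\in\mathbb{N}$ $$e_k(u:E\to C[0,1])\le 2\,\bigl\|u:E\to C_\lambda[0,1]\bigr\|^{\frac{1}{2\lambda+1}}\;e_k(u:E\to L_2[0,1])^{\frac{2\lambda}{2\lambda+1}}.$$
   Context: The Hölder space $C_\lambda[0,1]$ consists of all $f\in C[0,1]$ such that $$\|f\|_{C_\lambda[0,1]}:=\sup_{0\le s<t\le1}\frac{|f(t)-f(s)|}{|t-s|^{\lambda}}+\sup_{0\le t\le1}|f(t)|<\infty,$$ and is a Banach space under this norm. $C[0,1]$ carries the supremum norm. Since $C_\lambda[0,1]\subset C[0,1]\subset L_2[0,1]$, the operator $u$ may also be regarded as an operator into $C[0,1]$ or $L_2[0,1]$; the notation $u:E\to F$ indicates the target space considered, and $\|u:E\to F\|$ is the corresponding operator norm. For a linear operator $u:E\to F$ between Banach spaces with closed unit balls $B_E,B_F$ and $n\in\mathbb{N}=\{1,2,\dots\}$, the entropy numbers are $$e_n(u:E\to F):=\inf\Bigl\{\varepsilon>0:\ \exists f_1,\dots,f_{2^{n-1}}\in F\ \text{such that}\ u(B_E)\subseteq\bigcup_{k=1}^{2^{n-1}}(f_k+\varepsilon B_F)\Bigr\}.$$ *)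

(* Defs.v *)
(* All normed spaces are real: the scalars are R : realType. *)
From HB Require Import structures.
From mathcomp Require Import all_boot all_order all_algebra.
From mathcomp Require Import generic_quotient ring_quotient.
From mathcomp Require Import all_classical all_reals all_analysis.
From mathcomp Require Import measurable_realfun ess_sup_inf.
Set Implicit Arguments.
Unset Strict Implicit.
Unset Printing Implicit Defensive.
Import Order.TTheory GRing.Theory Num.Theory.
Import numFieldNormedType.Exports.
Local Open Scope classical_set_scope.
Local Open Scope ring_scope.

Section linear_operators.
Context {R : realType} {E F : normedModType R}.

(* [sup] and [inf] are real-valued (0 on sets without a finite supremum or
   infimum), so both definitions are meaningful for bounded operators only. *)
Definition opnorm (u : {linear E -> F}) : R :=
  sup [set `|u x| | x in [set x : E | `|x| <= 1]].

(* Meant for n >= 1. *)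
Definition entropy_number (u : {linear E -> F}) (n : nat) : R :=
  inf [set eps : R | 0 < eps /\
    exists f : 'I_(2 ^ n.-1) -> F,
      u @` [set x : E | `|x| <= 1] `<=`
        \bigcup_(k in [set: 'I_(2 ^ n.-1)])
          [set f k + eps *: y | y in [set y : F | `|y| <= 1]]].

End linear_operators.

(* L_p(mu) as a normed space: the p-integrable functions of [LfunType] modulo
   the null functions ([LspaceType] has the classes but no vector space
   structure). *)
Section Lp_space.
Context d (T : measurableType d) (R : realType).
Variables (mu : {measure set T -> \bar R}) (p : \bar R) (p1 : (1 <= p)%E).
Implicit Types f g : LfunType mu p1.
Local Open Scope quotient_scope.

Definition Lp_null : {pred LfunType mu p1} :=
  [pred f : LfunType mu p1 | `[< (f : T -> R) = cst 0 %[ae mu] >]].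

Lemma Lp_nullP f : reflect ((f : T -> R) = cst 0 %[ae mu]) (f \in Lp_null).
Proof. exact: asboolP. Qed.

Lemma Lp_null_zmod_closed : zmod_closed Lp_null.
Proof.
split; first by apply/Lp_nullP; exact: aeW.
move=> f g /Lp_nullP f0 /Lp_nullP g0; apply/Lp_nullP.
by apply: filterS2 f0 g0 => x f0 g0 _; rewrite -[LHS]/(f x - g x) f0// g0// subr0.
Qed.

HB.instance Definition _ :=
  GRing.isZmodClosed.Build _ Lp_null Lp_null_zmod_closed.

Definition Lp := Quotient.quot Lp_null.
HB.instance Definition _ := GRing.Zmodule.on Lp.
HB.instance Definition _ := Quotient.on Lp.

Definition Lp_class f : Lp := \pi_Lp f.

Lemma Lp_classP f g : Lp_class f = Lp_class g <-> (f : T -> R) = g %[ae mu].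
Proof.
have -> : Lp_class f = Lp_class g <-> f - g \in Lp_null.
  by rewrite Quotient.idealrBE; split => [|/eqP//] fg; apply/eqP.
split=> [/Lp_nullP fg|fg].
  apply: filterS fg => x /(_ I); rewrite -[LHS]/(f x - g x) => /eqP.
  by rewrite subr_eq0 => /eqP.
apply/Lp_nullP; apply: filterS fg => x /(_ I) fg _.
by rewrite -[LHS]/(f x - g x) fg subrr.
Qed.

Lemma Lp_classK (q : Lp) : Lp_class (repr q) = q.
Proof. exact: reprK. Qed.

Lemma Lp_classD f g : Lp_class (f + g) = Lp_class f + Lp_class g.
Proof. exact: Quotient.pi_add. Qed.

Definition Lp_scale (a : R) (q : Lp) : Lp := Lp_class (a *: repr q).

Lemma Lp_class_scale a f : Lp_class (a *: f) = Lp_scale a (Lp_class f).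
Proof.
apply/Lp_classP; have /Lp_classP := Lp_classK (Lp_class f).
by apply: filterS => x /(_ I) h _; congr (a * _); exact/esym.
Qed.

Lemma Lp_scaleA a b q : Lp_scale a (Lp_scale b q) = Lp_scale (a * b) q.
Proof. by rewrite -[q]Lp_classK -!Lp_class_scale scalerA. Qed.

Lemma Lp_scale1 : left_id 1 Lp_scale.
Proof. by move=> q; rewrite -[q]Lp_classK -Lp_class_scale scale1r. Qed.

Lemma Lp_scaleDr : right_distributive Lp_scale +%R.
Proof.
move=> a q r; rewrite -[q]Lp_classK -[r]Lp_classK.
by rewrite -Lp_classD -!Lp_class_scale scalerDr Lp_classD.
Qed.

Lemma Lp_scaleDl q : {morph Lp_scale^~ q : a b / a + b}.
Proof.
by move=> a b; rewrite -[q]Lp_classK -!Lp_class_scale scalerDl Lp_classD.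
Qed.

HB.instance Definition _ := GRing.Zmodule_isLmodule.Build R Lp
  Lp_scaleA Lp_scale1 Lp_scaleDr Lp_scaleDl.

Lemma Lp_class_is_linear : linear Lp_class.
Proof. by move=> a f g; rewrite Lp_classD Lp_class_scale. Qed.

HB.instance Definition _ :=
  GRing.isLinear.Build R _ _ *:%R Lp_class Lp_class_is_linear.

Definition Lp_norm (q : Lp) : R :=
  fine ('N[mu]_p[EFin \o (repr q : LfunType mu p1)])%E.

Lemma Lp_norm_class f : Lp_norm (Lp_class f) = fine ('N[mu]_p[EFin \o f])%E.
Proof.
congr fine; have := Lp_classK (Lp_class f); move: (repr _) => g /Lp_classP gf.
have {}gf : \forall x \ae mu, g x = f x by apply: filterS gf => x /(_ I).
rewrite unlock; case: p p1 f g gf => [r|//|//] r1 f g gf /=.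
  congr poweR; apply: ae_eq_integral => //.
  - apply/measurable_EFinP; apply: (measurableT_comp (measurable_powR _)).
    exact: measurableT_comp.
  - apply/measurable_EFinP; apply: (measurableT_comp (measurable_powR _)).
    exact: measurableT_comp.
  - by apply: filterS gf => x -> _.
by case: ifPn => // _; apply: eq_ess_sup; apply: filterS gf => x /= ->.
Qed.

Lemma Lp_normD (q r : Lp) : Lp_norm (q + r) <= Lp_norm q + Lp_norm r.
Proof.
rewrite -[q]Lp_classK -[r]Lp_classK -Lp_classD !Lp_norm_class.
exact: ler_LnormD.
Qed.

Lemma Lp_normZ (a : R) (q : Lp) : Lp_norm (a *: q) = `|a| * Lp_norm q.
Proof.
rewrite -[q]Lp_classK -linearZ !Lp_norm_class.
by apply: EFin_inj; rewrite EFinM !finite_norm_fine LnormZ.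
Qed.

Lemma Lp_norm0_eq0 (q : Lp) : Lp_norm q = 0 -> q = 0.
Proof.
move=> /fine_Lnormr_eq0 q0; rewrite -[q]Lp_classK -[0](linear0 Lp_class).
exact/Lp_classP.
Qed.

HB.instance Definition _ := Lmodule_isNormed.Build R Lp
  Lp_normD Lp_normZ Lp_norm0_eq0.

Lemma Lp_normE f : (`|Lp_class f|)%:E = ('N[mu]_p[EFin \o f])%E.
Proof. by rewrite -finite_norm_fine -Lp_norm_class. Qed.

End Lp_space.

(* C[0,1], with functions defined on the subtype [0,1] of R. *)
Section C01.
Variable R : realType.

Definition I01 : set R := `[0, 1].

Definition cont01 : {pred I01 -> R} := [pred f : I01 -> R | `[< continuous f >]].

Lemma cont01P (f : I01 -> R) : reflect (continuous f) (f \in cont01).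
Proof. exact: asboolP. Qed.

Lemma cont01_submod_closed : submod_closed cont01.
Proof.
split; first by apply/cont01P; exact: (@cst_continuous _ _ (0 : R)).
move=> a f g /cont01P cf /cont01P cg; apply/cont01P => x.
by apply: cvgD (cg x); apply: cvgM (cf x); exact: cvg_cst.
Qed.

HB.instance Definition _ :=
  GRing.isSubmodClosed.Build R (I01 -> R) cont01 cont01_submod_closed.

Record C01 := MkC01 { C01_fun :> I01 -> R; C01_mem : C01_fun \in cont01 }.
HB.instance Definition _ := [isSub for C01_fun].
HB.instance Definition _ := [Choice of C01 by <:].
HB.instance Definition _ := [SubChoice_isSubLmodule of C01 by <:].

Implicit Types f g : C01.

Lemma C01_continuous f : continuous f.
Proof. exact/cont01P/C01_mem. Qed.

Lemma C01_valL_continuous f : {within I01, continuous ('valL_0 (f : I01 -> R))}.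
Proof. by apply/subspace_valL_continuousP'; exact: C01_continuous. Qed.

Lemma C01_valL f (t : I01) : 'valL_0 (f : I01 -> R) (val t) = f t.
Proof. by have := congr1 (@^~ t) (valLK 0 (f : I01 -> R)). Qed.

Lemma C01_valLE f :
  'valL_0 (f : I01 -> R) = 'valL_0 (f : I01 -> R) \_ (I01 : set R).
Proof. by rewrite -[RHS]/(patch (fun=> 0) _ _) -sigLK/= valLK. Qed.

Lemma C01_valL_out f (x : R) : x \notin I01 -> 'valL_0 (f : I01 -> R) x = 0.
Proof. by rewrite C01_valLE patchE => /negbTE ->. Qed.

Lemma I01_0 : (0 : R) \in I01. Proof. by rewrite inE /I01 /= in_itv/= lexx ler01. Qed.
Lemma I01_1 : (1 : R) \in I01. Proof. by rewrite inE /I01 /= in_itv/= lexx ler01. Qed.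

Definition C01_norm f : R := sup (range (fun t => `|f t|)).

Lemma C01_has_sup f : has_sup (range (fun t => `|f t|)).
Proof.
split; first by exists `|f (exist _ 0 I01_0)|, (exist _ 0 I01_0).
have /compact_bounded [M [_ Mf]] :
    compact ('valL_0 (f : I01 -> R) @` (I01 : set R)).
  by apply: continuous_compact; [exact: C01_valL_continuous|exact: segment_compact].
exists (M + 1) => _ [t _ <-]; rewrite -C01_valL; apply: Mf; first by rewrite ltrDl.
by exists (val t) => //; exact: set_valP.
Qed.

Lemma C01_norm_ge f t : `|f t| <= C01_norm f.
Proof. by apply: sup_upper_bound; [exact: C01_has_sup|exists t]. Qed.

Lemma C01_norm_le f M : (forall t, `|f t| <= M) -> C01_norm f <= M.
Proof.
move=> fM; apply: sup_le_ub; first by case: (C01_has_sup f).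
by move=> _ [t _ <-].
Qed.

Lemma C01_normD f g : C01_norm (f + g) <= C01_norm f + C01_norm g.
Proof.
apply: C01_norm_le => t; apply: le_trans (ler_normD _ _) _.
by rewrite lerD ?C01_norm_ge.
Qed.

Lemma C01_normZ (a : R) f : C01_norm (a *: f) = `|a| * C01_norm f.
Proof.
have le (b : R) g : C01_norm (b *: g) <= `|b| * C01_norm g.
  apply: C01_norm_le => t; rewrite [X in `|X|](_ : _ = b * g t)// normrM.
  by rewrite ler_wpM2l ?C01_norm_ge.
have [->|a0] := eqVneq a 0.
  apply/eqP; rewrite eq_le le/= normr0 mul0r.
  exact: le_trans (C01_norm_ge _ (exist _ 0 I01_0)).
apply/eqP; rewrite eq_le le/= -ler_pdivlMl ?normr_gt0//.
by rewrite -[X in C01_norm X <= _](scalerK a0) -normfV le.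
Qed.

Lemma C01_norm0_eq0 f : C01_norm f = 0 -> f = 0.
Proof.
move=> f0; apply: val_inj; apply/funext => t /=; apply/eqP.
by rewrite -normr_le0 -f0 C01_norm_ge.
Qed.

HB.instance Definition _ := Lmodule_isNormed.Build R C01
  C01_normD C01_normZ C01_norm0_eq0.

Lemma C01_normE f : `|f| = sup (range (fun t => `|f t|)).
Proof. by []. Qed.

End C01.
Arguments I01 : clear implicits.

Section Holder.
Variables (R : realType) (lam : R).
Implicit Types f g : C01 R.
Local Open Scope ereal_scope.

Definition holder_seminorm f : \bar R :=
  ereal_sup [set (`|f st.2 - f st.1| / `|val st.2 - val st.1| `^ lam)%:E |
    st in [set st : I01 R * I01 R | (val st.1 < val st.2)%R]].

Definition holder_enorm f : \bar R := holder_seminorm f + `|f|%:E.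

Lemma holder_seminorm_ge f (s t : I01 R) : (val s < val t)%R ->
  (`|f t - f s| / `|val t - val s| `^ lam)%:E <= holder_seminorm f.
Proof. by move=> st; apply: ereal_sup_ubound; exists (s, t). Qed.

Lemma holder_seminorm_ge0 f : 0 <= holder_seminorm f.
Proof.
apply: le_trans (@holder_seminorm_ge f (exist _ 0%R (I01_0 R))
  (exist _ 1%R (I01_1 R)) (ltr01 : (_ < _)%R)).
by rewrite lee_fin divr_ge0 ?powR_ge0.
Qed.

Lemma holder_seminormD f g :
  holder_seminorm (f + g)%R <= holder_seminorm f + holder_seminorm g.
Proof.
apply: ge_ereal_sup => _ [[s t] /= st <-].
apply: le_trans (leeD (holder_seminorm_ge f st) (holder_seminorm_ge g st)).
rewrite -EFinD lee_fin -mulrDl ler_wpM2r ?invr_ge0 ?powR_ge0//.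
rewrite [X in `|X|%R](_ : _ = (f t - f s) + (g t - g s))%R ?ler_normD//.
by rewrite -[LHS]/((f t + g t) - (f s + g s))%R opprD addrACA.
Qed.

Lemma holder_seminormZ (a : R) f :
  holder_seminorm (a *: f)%R = `|a|%:E * holder_seminorm f.
Proof.
rewrite /holder_seminorm -ereal_supZl//; last first.
  apply/set0P; eexists; exists (exist _ 0%R (I01_0 R), exist _ 1%R (I01_1 R)) => //.
  exact: (ltr01 : (_ < _)%R).
congr ereal_sup; rewrite image_comp; apply: eq_imagel => -[s t] _ /=.
rewrite -EFinM mulrA -normrM mulrBr; congr (_ / _)%:E.
Qed.

Lemma holder_enormD f g :
  holder_enorm (f + g)%R <= holder_enorm f + holder_enorm g.
Proof.
rewrite /holder_enorm addeACA leeD ?holder_seminormD//.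
by rewrite -EFinD lee_fin ler_normD.
Qed.

Lemma holder_enormZ (a : R) f :
  holder_enorm (a *: f)%R = `|a|%:E * holder_enorm f.
Proof.
rewrite /holder_enorm holder_seminormZ normrZ EFinM.
by rewrite ge0_muleDr ?holder_seminorm_ge0 ?lee_fin.
Qed.

Lemma holder_enorm_ge0 f : 0 <= holder_enorm f.
Proof. by rewrite adde_ge0 ?holder_seminorm_ge0 ?lee_fin. Qed.

Definition holder_pred : {pred C01 R} :=
  [pred f : C01 R | holder_enorm f < +oo].

Lemma holder_submod_closed : submod_closed holder_pred.
Proof.
split.
  rewrite inE -(scale0r (0%R : C01 R)) holder_enormZ normr0 mul0e; exact: ltry.
move=> a f g; rewrite !inE => foo goo.
apply: le_lt_trans (holder_enormD _ _) _; apply: lte_add_pinfty => //.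
by rewrite holder_enormZ lte_mul_pinfty ?lee_fin.
Qed.

HB.instance Definition _ :=
  GRing.isSubmodClosed.Build R (C01 R) holder_pred holder_submod_closed.

Record Holder :=
  MkHolder { Holder_C01 :> C01 R; Holder_mem : Holder_C01 \in holder_pred }.
HB.instance Definition _ := [isSub for Holder_C01].
HB.instance Definition _ := [Choice of Holder by <:].
HB.instance Definition _ := [SubChoice_isSubLmodule of Holder by <:].

Local Close Scope ereal_scope.
Implicit Types h : Holder.

Lemma Holder_C01_is_linear : linear Holder_C01. Proof. by []. Qed.
HB.instance Definition _ :=
  GRing.isLinear.Build R Holder (C01 R) *:%R Holder_C01 Holder_C01_is_linear.

Definition Holder_norm h : R := fine (holder_enorm h).

Lemma Holder_normE h : (Holder_norm h)%:E = holder_enorm h.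
Proof.
by rewrite fineK// ge0_fin_numE ?holder_enorm_ge0//; exact: Holder_mem.
Qed.

Lemma Holder_normD h k : Holder_norm (h + k) <= Holder_norm h + Holder_norm k.
Proof. by rewrite -lee_fin EFinD !Holder_normE holder_enormD. Qed.

Lemma Holder_normZ (a : R) h : Holder_norm (a *: h) = `|a| * Holder_norm h.
Proof. by apply: EFin_inj; rewrite EFinM !Holder_normE holder_enormZ. Qed.

Lemma Holder_norm0_eq0 h : Holder_norm h = 0 -> h = 0.
Proof.
move=> h0; apply: val_inj; apply/eqP; rewrite -normr_le0 -lee_fin -h0.
by rewrite Holder_normE leeDr// holder_seminorm_ge0.
Qed.

HB.instance Definition _ := Lmodule_isNormed.Build R Holder
  Holder_normD Holder_normZ Holder_norm0_eq0.

Lemma Holder_normEsup h : (`|h|)%:E = (holder_seminorm h + `|Holder_C01 h|%:E)%E.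
Proof. exact: Holder_normE. Qed.

End Holder.
Arguments Holder_C01 {R lam}.

(* L_2[0,1] is realized on R with Lebesgue measure restricted to [0,1]: what a
   function does outside [0,1] is invisible, and ['valL_0 f] extends by 0 a
   function f defined on the subtype [0,1]. *)
Section L2_01.
Variable R : realType.

Definition leb01 : set (measurableTypeR R) -> \bar R :=
  mrestr (@lebesgue_measure R) (measurable_itv `[0, 1]).
HB.instance Definition _ := Measure.on leb01.

Definition L2_01 : Type := Lp leb01 (lee1n 2).
HB.instance Definition _ := NormedModule.on L2_01.

Lemma leb01T : leb01 setT = 1%E.
Proof.
rewrite /leb01 /mrestr setTI lebesgue_measure_itv/= lte_fin ltr01.
by rewrite oppr0 adde0.
Qed.

Lemma C01_Lfun (f : C01 R) :
  ('valL_0 (f : I01 R -> R) : measurableTypeR R -> R) \in Lfun leb01 2%:R%:E.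
Proof.
set F := 'valL_0 _.
have mF : measurable_fun setT (F : measurableTypeR R -> R).
  rewrite /F C01_valLE.
  apply/(measurable_restrictT _ (measurable_itv `[0, 1])).
  apply: subspace_continuous_measurable_fun; first exact: measurable_itv.
  exact: C01_valL_continuous.
have Fle x : `|F x| <= `|f|.
  have [xI|xI] := boolP (x \in I01 R); last by rewrite /F C01_valL_out// normr0.
  by rewrite /F (C01_valL f (exist _ x xI)) C01_norm_ge.
rewrite inE; apply/andP; split; rewrite inE//= /finite_norm unlock.
apply: poweR_lty.
apply: (@le_lt_trans _ _ (\int[leb01]_x cst (`|f| `^ 2)%:E x)%E).
  apply: ge0_le_integral => //=.
  - apply/measurable_EFinP; apply: (measurableT_comp (measurable_powR _)).
    exact: measurableT_comp.
  - by move=> x _; rewrite lee_fin ge0_ler_powR ?nnegrE.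
rewrite integral_cst// -[X in (_ * X < _)%E]/(leb01 setT).
by rewrite [X in (_ * X < _)%E]leb01T mule1 ltry.
Qed.

Definition C01_L2 (f : C01 R) : L2_01 :=
  Lp_class (Lfun_Sub (lee1n 2) (C01_Lfun f)).

Lemma C01_L2_is_linear : linear C01_L2.
Proof.
move=> a f g; rewrite /C01_L2 -linearP; apply/Lp_classP; apply: aeW => x _.
rewrite -[RHS]/(a * 'valL_0 (f : I01 R -> R) x + 'valL_0 (g : I01 R -> R) x).
rewrite -[LHS]/('valL_0 ((a *: f + g : C01 R) : I01 R -> R) x).
have [xI|xI] := boolP (x \in I01 R).
  have vE (h : C01 R) : 'valL_0 (h : I01 R -> R) x = h (exist _ x xI).
    exact: (C01_valL h (exist _ x xI)).
  by rewrite !vE.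
by rewrite !C01_valL_out// mulr0 addr0.
Qed.
HB.instance Definition _ :=
  GRing.isLinear.Build R (C01 R) L2_01 *:%R C01_L2 C01_L2_is_linear.

Lemma C01_L2_normE (f : C01 R) :
  (`|C01_L2 f|)%:E = ('N[leb01]_2%:R%:E[EFin \o 'valL_(0%R) (f : I01 R -> R)])%E.
Proof. exact: Lp_normE. Qed.

End L2_01.
Arguments C01_L2 {R}.

(* Main.v *)
(* Let M be the norm of u and q = 2 lam + 1.  A Hölder function that is at least
   c + |h| d^lam in absolute value at a point is at least c on an interval of
   length d around it; comparing with the L_2 norm and optimizing over d gives
     |h|_oo <= 2 |h|_lam^(1/q) |h|_2^(2 lam/q).
   If L_2-balls of radius e cover the image of the unit ball, two images in the
   same ball differ by at most 2M in the Hölder norm and 2e in L_2.  As the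
   exponents add up to 1, they differ by at most 2r in the supremum norm, where
   r = 2 M^(1/q) e^(2 lam/q).  A factor 2 would be lost by centering a sup-norm
   ball at one of the images; instead, an equicontinuous set of sup-norm diameter
   2r lies in a ball of radius r about a suitable continuous function. *)
Require Import Defs.
From mathcomp Require Import all_boot all_order all_algebra.
From mathcomp Require Import all_classical all_reals all_analysis.
From mathcomp Require Import measurable_realfun.
From mathcomp Require Import ring lra.
Import Order.TTheory GRing.Theory Num.Theory.
Import numFieldNormedType.Exports.
Local Open Scope classical_set_scope.
Local Open Scope ring_scope.

(** * Coverings by balls and operator norms *)

Lemma entropy_number_le (R : realType) (E F : normedModType R)
  (u : {linear E -> F}) (n : nat) (r : R) (c : 'I_(2 ^ n.-1) -> F) : 0 < r ->
  (forall x : E, `|x| <= 1 -> exists k, `|u x - c k| <= r) ->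
  entropy_number u n <= r.
Proof.
move=> r0 cover; apply: ge_inf; first by exists 0 => e [/ltW].
split=> //; exists c => _ [x /= /cover[k uxc] <-]; exists k => //=.
exists (r^-1 *: (u x - c k)).
  by rewrite normrZ normfV gtr0_norm// ler_pdivrMl// mulr1.
by rewrite scalerA divff ?gt_eqF// scale1r addrC subrK.
Qed.

(** Boundedness of [u] supplies one admissible radius; the infimum of an empty set would be the
    default value 0. *)
Lemma le_entropy_number (R : realType) (E F : normedModType R)
  (u : {linear E -> F}) (n : nat) (a : R) : bounded_fun_norm u ->
  (forall (r : R) (c : 'I_(2 ^ n.-1) -> F), 0 < r ->
    (forall x : E, `|x| <= 1 -> exists k, `|u x - c k| <= r) -> a <= r) ->
  a <= entropy_number u n.
Proof.
move=> bu aP; apply: lb_le_inf.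
  have [M uM] := bu 1.
  have M0 : 0 < `|M| + 1 by rewrite ltr_wpDl.
  exists (`|M| + 1); split=> //; exists (fun=> 0) => _ [x /= /uM uxM <-].
  have k0 : (0 < 2 ^ n.-1)%N by rewrite expn_gt0.
  exists (Ordinal k0) => //=; exists ((`|M| + 1)^-1 *: u x).
    rewrite normrZ normfV gtr0_norm// ler_pdivrMl// mulr1.
    by rewrite (le_trans uxM)// (le_trans (ler_norm _))// lerDl.
  by rewrite scalerA divff ?gt_eqF// scale1r add0r.
move=> r [r0 [c cover]]; apply: (aP r c r0) => x x1.
have [|k _ [y /= y1 <-]] := cover (u x); first by exists x.
exists k; rewrite addrC addKr normrZ gtr0_norm//.
by rewrite ler_piMr// ltW.
Qed.

Lemma opnorm_ge (R : realType) (E F : normedModType R)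
  (u : {linear E -> F}) (x : E) : bounded_fun_norm u -> `|x| <= 1 ->
  `|u x| <= opnorm u.
Proof.
move=> bu x1; apply: sup_upper_bound; last by exists x.
split; first by exists `|u x|, x.
by have [M uM] := bu 1; exists M => _ [y /= /uM uyM <-].
Qed.

(** * Hölder, supremum and L_2 norms *)

Lemma Holder_le (R : realType) (lam : R) (h : Holder lam) (s t : I01 R) :
  `|Holder_C01 h t - Holder_C01 h s| <= `|h| * `|val t - val s| `^ lam.
Proof.
have le_lt (a b : I01 R) : val a < val b ->
    `|Holder_C01 h b - Holder_C01 h a| <= `|h| * `|val b - val a| `^ lam.
  move=> ab; rewrite -ler_pdivrMr; last first.
    by rewrite powR_gt0// normr_gt0 subr_eq0 gt_eqF.
  rewrite -lee_fin Holder_normEsup.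
  by apply: le_trans (holder_seminorm_ge _ _ ab) _; rewrite leeDl ?lee_fin.
have [st|ts|/val_inj ->] := ltgtP (val s) (val t).
- exact: le_lt.
- by rewrite distrC (distrC (val t)); exact: le_lt.
- by rewrite subrr normr0 mulr_ge0// powR_ge0.
Qed.

Lemma Holder_C01_le (R : realType) (lam : R) (h : Holder lam) :
  `|Holder_C01 h| <= `|h|.
Proof. by rewrite -lee_fin Holder_normEsup leeDr// holder_seminorm_ge0. Qed.

Lemma measurable_C01_sqr (R : realType) (g : C01 R) :
  measurable_fun setT (fun x : measurableTypeR R =>
    (`|('valL_0 (g : I01 R -> R) : R -> R) x| `^ 2)%:E).
Proof.
have mg : measurable_fun setT ('valL_0 (g : I01 R -> R) : measurableTypeR R -> R).
  by have := C01_Lfun g; rewrite inE => /andP[+ _]; rewrite inE.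
apply/measurable_EFinP; apply: (measurableT_comp (measurable_powR _)).
exact: measurableT_comp.
Qed.

(** [leb01] has total mass 1. This carries boundedness of the operator over to L_2. *)
Lemma C01_L2_le (R : realType) (g : C01 R) : `|C01_L2 g| <= `|g|.
Proof.
rewrite -lee_fin C01_L2_normE unlock /=.
have -> : `|g| = (`|g| `^ 2) `^ 2^-1 by rewrite -powRrM divff// powRr1.
rewrite -poweR_EFin; apply: gt0_ler_poweR; rewrite ?invr_ge0//.
- by rewrite in_itv/= leey andbT; apply: integral_ge0 => x _; rewrite lee_fin powR_ge0.
- by rewrite in_itv/= leey andbT lee_fin powR_ge0.
apply: (@le_trans _ _ (\int[@leb01 R]_x cst (`|g| `^ 2)%:E x)%E); last first.
  by rewrite integral_cst// -[X in (_ * X <= _)%E]/(@leb01 R setT) leb01T mule1.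
apply: ge0_le_integral => //=.
- exact: measurable_C01_sqr.
move=> x _; rewrite lee_fin ge0_ler_powR ?nnegrE//.
rewrite -[X in `|X|]/(('valL_0 (g : I01 R -> R) : R -> R) x).
have [xI|xI] := boolP (x \in I01 R); last by rewrite C01_valL_out// normr0.
by rewrite (C01_valL g (exist _ x xI)) C01_norm_ge.
Qed.

(** Restricting the integral of g^2 to [a, b] leaves at least c^2 (b - a). *)
Lemma C01_L2_ge (R : realType) (g : C01 R) (a b c : R) :
  0 <= a -> a <= b -> b <= 1 -> 0 <= c ->
  (forall t : I01 R, a <= val t <= b -> c <= `|g t|) ->
  c * (b - a) `^ 2^-1 <= `|C01_L2 g|.
Proof.
move=> a0 ab b1 c0 cg.
have ba0 : 0 <= b - a by rewrite subr_ge0.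
rewrite -lee_fin C01_L2_normE unlock /=.
have -> : c * (b - a) `^ 2^-1 = (c `^ 2 * (b - a)) `^ 2^-1.
  by rewrite powRM ?powR_ge0// -powRrM divff// powRr1.
rewrite -poweR_EFin; apply: gt0_ler_poweR; rewrite ?invr_ge0//.
- rewrite in_itv/= leey andbT lee_fin.
  by rewrite mulr_ge0// powR_ge0.
- by rewrite in_itv/= leey andbT; apply: integral_ge0 => x _; rewrite lee_fin powR_ge0.
have mI : measurable (`[a, b]%classic : set (measurableTypeR R)) by exact: measurable_itv.
have mf := measurable_C01_sqr _ g.
apply: (@le_trans _ _ (\int[@leb01 R]_(x in `[a, b]) cst (c `^ 2)%:E x)%E).
  rewrite integral_cst// EFinM; rewrite lee_wpmul2l ?lee_fin ?powR_ge0//.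
  rewrite -[X in (_ <= X)%E]/(lebesgue_measure (`[a, b] `&` `[0, 1])) setIidl; last first.
    move=> x /=; rewrite !in_itv/= => /andP[ax xb].
    by rewrite (le_trans a0 ax) (le_trans xb b1).
  rewrite lebesgue_measure_itv/= lte_fin; case: ifPn => //.
  by rewrite -leNgt => ba; rewrite lee_fin subr_le0.
apply: (@le_trans _ _ (\int[@leb01 R]_(x in `[a, b])
    (`|('valL_0 (g : I01 R -> R) : R -> R) x| `^ 2)%:E)%E).
  apply: ge0_le_integral => //=.
  - by move=> x _; rewrite lee_fin powR_ge0.
  - exact: measurable_funTS mf.
  - move=> x; rewrite in_itv/= => /andP[ax xb].
    have xI : x \in I01 R.
      by rewrite inE /I01/= in_itv/= (le_trans a0 ax) (le_trans xb b1).
    rewrite lee_fin ge0_ler_powR ?nnegrE//.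
    rewrite -[X in `|X|]/(('valL_0 (g : I01 R -> R) : R -> R) x).
    by rewrite (C01_valL g (exist _ x xI)) cg//= ax xb.
by apply: ge0_subset_integral => // x _; rewrite lee_fin powR_ge0.
Qed.

(** * Interpolation of the supremum norm *)

Lemma Holder_le_L2_scale (R : realType) (lam : R) (h : Holder lam) (d : R) :
  0 < lam -> 0 < d <= 1 ->
  `|Holder_C01 h| <= `|h| * d `^ lam + `|C01_L2 (Holder_C01 h)| * d `^ (- 2^-1).
Proof.
move=> lam0 /andP[d0 d1]; apply: C01_norm_le => t.
have /andP[t0 t1] : 0 <= val t <= 1 by have := set_valP t; rewrite /I01 /= in_itv.
have [|le_c] := lerP (`|Holder_C01 h t| - `|h| * d `^ lam) 0.
  rewrite subr_le0 => /le_trans; apply.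
  by rewrite lerDl mulr_ge0// powR_ge0.
rewrite -lerBlDl powRN ler_pdivlMr ?powR_gt0//.
(* [a, a + d] is a window of length d that contains t and stays inside [0, 1] *)
pose a := val t * (1 - d).
have -> : d `^ 2^-1 = (a + d - a) `^ 2^-1 by rewrite addrAC subrr add0r.
have ta : val t = a + val t * d by rewrite /a; ring.
apply: C01_L2_ge.
- by rewrite mulr_ge0// subr_ge0.
- by rewrite lerDl ltW.
(* The right end stays in [0, 1] because 1 - (a + d) = (1 - t)(1 - d). *)
- by rewrite /a; nra.
- exact: ltW.
move=> s /andP[as_ sd].
have : `|val t - val s| `^ lam <= d `^ lam.
  rewrite ge0_ler_powR ?nnegrE ?(ltW lam0) ?(ltW d0)//.
  have : 0 <= val t * d <= d by nra.
  by rewrite ler_norml; lra.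
move=> /(ler_wpM2l (normr_ge0 h)) le_d.
have := Holder_le _ _ h s t; have := lerB_dist (Holder_C01 h t) (Holder_C01 h s).
lra.
Qed.

(** Positive upper bounds [N] and [e] replace the two norms, so that e / N is defined and positive
    even when a norm vanishes. *)
Lemma Holder_L2_interpolation (R : realType) (lam : R) (h : Holder lam) (N e : R) :
  0 < lam -> 0 < N -> 0 < e -> `|h| <= N -> `|C01_L2 (Holder_C01 h)| <= e ->
  `|Holder_C01 h| <=
    2 * (N `^ (1 / (2 * lam + 1)) * e `^ (2 * lam / (2 * lam + 1))).
Proof.
move=> lam0 N0 e0 hN he.
set q := 2 * lam + 1; have q0 : 0 < q by rewrite /q; lra.
have sum1 : 1 / q + 2 * lam / q = 1.
  by rewrite -mulrDl addrC divff// gt_eqF.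
have powR_ratio (x y : R) : N `^ x * e `^ y = N `^ (x + y) * (e / N) `^ y.
  rewrite powRM ?invr_ge0 ?ltW// powRD; last by rewrite (gt_eqF N0) implybT.
  rewrite -powR_inv1 ?ltW// -powRrM mulN1r powRN mulrACA divff ?mulr1//.
  by rewrite gt_eqF ?powR_gt0.
have eN : 0 < e / N by rewrite divr_gt0.
(* For e > N the balancing scale would exceed the length of [0, 1]; the trivial bound by N is then
   enough, since (e / N)^(2 lam / q) >= 1. *)
have [le_eN|lt_Ne] := leP e N; last first.
  rewrite powR_ratio sum1 powRr1 ?(ltW N0)//.
  apply: le_trans (Holder_C01_le _ _ h) _; apply: (le_trans hN).
  rewrite mulrCA ler_peMr ?(ltW N0)// mulr_ege1// ?ler1n//.
  rewrite -[leLHS](powRr0 (e / N)) ler_powR ?divr_ge0 ?mulr_ge0 ?(ltW lam0) ?(ltW q0)//.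
  by rewrite ler_pdivlMr// mul1r ltW.
(* the scale that equates the two error terms [N d^lam] and [e d^(-1/2)] *)
pose d := (e / N) `^ (2 / q).
have d0 : 0 < d by rewrite powR_gt0.
have d1 : d <= 1.
  have eN1 : 0 < e / N <= 1 by rewrite eN ler_pdivrMr// mul1r.
  by rewrite /d -[leRHS](powRr0 (e / N)) ger_powR// divr_ge0// ltW.
have d01 : 0 < d <= 1 by rewrite d0.
apply: le_trans (Holder_le_L2_scale _ _ h d lam0 d01) _.
rewrite [leRHS]mulr_natl [leRHS]mulr2n lerD//.
- apply: le_trans (ler_wpM2r (powR_ge0 _ _) hN) _.
  rewrite powR_ratio sum1 powRr1 ?(ltW N0)// /d -powRrM.
  by rewrite mulrAC.
- apply: le_trans (ler_wpM2r (powR_ge0 _ _) he) _.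
  rewrite powR_ratio sum1 powRr1 ?(ltW N0)// /d -powRrM.
  (* Here e d^(-1/2) = N (e / N)^(1 - 1/q), and 1 - 1/q = 2 lam / q. *)
  have {1}-> : e = N * (e / N) by rewrite mulrC divfK// gt_eqF.
  rewrite -[leLHS]mulrA ler_pM2l//.
  rewrite -{1}[e / N]powRr1 ?(ltW eN)// -powRD; last by rewrite (gt_eqF eN) implybT.
  by rewrite (_ : 1 + _ = 2 * lam / q)// /q; field; rewrite gt_eqF.
Qed.

(** * Centers of equicontinuous sets *)

(* The center is the pointwise infimum raised by r. *)
Lemma C01_center (R : realType) (A : set (C01 R)) (lam M r : R) :
  0 < lam -> 0 <= M ->
  (forall g s t, A g -> `|g t - g s| <= M * `|val t - val s| `^ lam) ->
  (forall f g, A f -> A g -> `|f - g| <= 2 * r) ->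
  exists c : C01 R, forall g, A g -> `|g - c| <= r.
Proof.
move=> lam0 M0 AM Ar.
have [[g0 Ag0]|A0] := pselect (A !=set0); last first.
  by exists 0 => g Ag; exfalso; apply: A0; exists g.
pose S t := [set g t | g in A].
pose c t := inf (S t) + r.
have le2r f g t : A f -> A g -> f t - g t <= 2 * r.
  move=> Af Ag; apply: le_trans (ler_norm _) _.
  exact: le_trans (C01_norm_ge (f - g) t) (Ar _ _ Af Ag).
have lb t : has_lbound (S t).
  by exists (g0 t - 2 * r) => _ [g Ag <-]; have := le2r g0 g t Ag0 Ag; lra.
have inf_le g t : A g -> inf (S t) <= g t.
  by move=> Ag; apply: ge_inf => //; exists g.
have le_inf a t : (forall g, A g -> a <= g t) -> a <= inf (S t).
  by move=> aA; apply: lb_le_inf => [|_ [g Ag <-]]; [exists (g0 t), g0|exact: aA].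
(* A common Hölder modulus passes to the pointwise infimum, which makes [c] continuous. *)
have cM s t : c t - c s <= M * `|val t - val s| `^ lam.
  suff : inf (S t) - M * `|val t - val s| `^ lam <= inf (S s) by rewrite /c; lra.
  apply: le_inf => g Ag; have := inf_le g t Ag.
  by have := AM g s t Ag; rewrite ler_norml; lra.
have cc : c \in @cont01 R.
  apply/cont01P => t; apply/(@cvgrPdist_le _ R^o _ _ (nbhs_filter t)) => e e0 /=.
  have M1 : 0 < M + 1 by lra.
  (* This gives (M + 1) d^lam = e; dividing by M + 1 allows M = 0. *)
  pose d := (e / (M + 1)) `^ lam^-1.
  have d0 : 0 < d by rewrite powR_gt0// divr_gt0.
  have : \forall s \near t, `|val t - val s| <= d.
    have /cvgrPdist_le/(_ _ d0) := @initial_continuous _ _ (set_val : I01 R -> R) t.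
    by apply: filterS => s.
  apply: (@filterS _ _ (nbhs_filter t)) => s ts.
  have {ts} : M * `|val t - val s| `^ lam <= e.
    apply: (@le_trans _ _ (M * d `^ lam)).
      by rewrite ler_wpM2l// ge0_ler_powR ?nnegrE// ltW.
    rewrite /d -powRrM mulVf ?gt_eqF// powRr1; last by rewrite divr_ge0 ?ltW.
    by rewrite mulrA ler_pdivrMr// mulrC ler_pM2l//; lra.
  by have := cM s t; have := cM t s; rewrite (distrC (val s)) ler_norml; lra.
exists (MkC01 cc) => g Ag; apply: C01_norm_le => t.
rewrite -[X in `|X|]/(g t - c t) ler_norml /c.
(* The infimum lies between g t - 2 r and g t, so raising it by r leaves an error of at most r on
   either side. *)
have := inf_le g t Ag.
have : g t - 2 * r <= inf (S t) by apply: le_inf => f Af; have := le2r g f t Ag Af; lra.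
lra.
Qed.

(** * From L_2 coverings to sup-norm coverings *)

Theorem theorem5 (R : realType) (E : completeNormedModType R) (lam : R)
  (lam0 : 0 < lam) (lam1 : lam <= 1)
  (u : {linear E -> Holder lam}) (bu : bounded_fun_norm u)
  (k : nat) (k1 : (1 <= k)%N) :
  entropy_number (Holder_C01 \o u) k <=
    2 * opnorm u `^ (1 / (2 * lam + 1)) *
    entropy_number (C01_L2 \o (Holder_C01 \o u)) k
      `^ (2 * lam / (2 * lam + 1)).
Proof.
set q := 2 * lam + 1; have q0 : 0 < q by rewrite /q; lra.
set M := opnorm u; set e2 := entropy_number (C01_L2 \o _) k.
have uM x : `|x| <= 1 -> `|u x| <= M by exact: opnorm_ge.
have M0 : 0 <= M by apply: le_trans (uM 0 _); rewrite ?normr0.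
(* If M = 0, the unit ball is sent to 0 and every positive radius is admissible; the interpolation
   needs a positive bound. *)
have [M_eq0|Mn0] := eqVneq M 0.
  rewrite M_eq0 powR0 ?mulr0 ?mul0r; last by rewrite mulf_neq0// ?invr_eq0 gt_eqF.
  apply/ler_addgt0Pr => e e0; rewrite add0r.
  apply: (entropy_number_le _ _ _ _ _ _ (fun=> 0)) => // x /uM.
  have k0 : (0 < 2 ^ k.-1)%N by rewrite expn_gt0.
  rewrite M_eq0 subr0 => ux0; exists (Ordinal k0).
  exact: le_trans (Holder_C01_le _ _ (u x)) (le_trans ux0 (ltW e0)).
have {}M0 : 0 < M by rewrite lt_def Mn0.
have Mq : 0 < 2 * M `^ (1 / q) by rewrite mulr_gt0// powR_gt0.
have lamq : 0 < 2 * lam / q by rewrite divr_gt0// mulr_gt0.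
rewrite -ler_pdivrMl//; set a := _ * entropy_number _ _.
have [a0|a0] := leP a 0; first exact: le_trans a0 (powR_ge0 _ _).
(* Inverting the power isolates the infimum [e2], so that each admissible L_2 radius can be treated
   separately. *)
suff : a `^ (2 * lam / q)^-1 <= e2.
  move=> ae; have -> : a = (a `^ (2 * lam / q)^-1) `^ (2 * lam / q).
    by rewrite -powRrM mulVf ?gt_eqF// powRr1// ltW.
  apply: ge0_ler_powR; rewrite ?nnegrE ?powR_ge0 ?(ltW lamq)//.
  exact: le_trans (powR_ge0 _ _) ae.
apply: le_entropy_number.
  move=> r; have [N uN] := bu r; exists N => x /uN; apply: le_trans.
  exact: le_trans (C01_L2_le _ _) (Holder_C01_le _ _ (u x)).
move=> e c e0 cover.
suff ae : a <= e `^ (2 * lam / q).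
  have -> : e = (e `^ (2 * lam / q)) `^ (2 * lam / q)^-1.
    by rewrite -powRrM mulfV ?gt_eqF// powRr1// ltW.
  by apply: ge0_ler_powR; rewrite ?nnegrE ?powR_ge0 ?invr_ge0 ?(ltW lamq) ?(ltW a0).
rewrite /a ler_pdivrMl//; set r := _ * _.
have r0 : 0 < r by rewrite mulr_gt0// powR_gt0.
(* The L_2 center [c i] need not be the class of a continuous function, so the images in each L_2
   ball receive a new center [b i]; the number of balls is unchanged. *)
pose A i := [set g | exists x, [/\ `|x| <= 1, g = Holder_C01 (u x) &
  `|C01_L2 g - c i| <= e]].
have /choice[b bA] : forall i, exists b, forall g, A i g -> `|g - b| <= r.
  move=> i; apply: (C01_center _ _ lam M) => //; first exact: ltW.
    move=> _ s t [x [x1 -> _]]; apply: le_trans (Holder_le _ _ (u x) s t) _.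
    by rewrite ler_wpM2r ?powR_ge0// uM.
  move=> _ _ [x [x1 -> xe]] [y [y1 -> ye]].
  (* the two exponents add up to 1 *)
  have -> : 2 * r = 2 * ((2 * M) `^ (1 / q) * (2 * e) `^ (2 * lam / q)).
    rewrite !powRM ?ltW// mulrACA -powRD; last by rewrite pnatr_eq0 implybT.
    rewrite -mulrDl (addrC 1) divff ?gt_eqF// powRr1//.
    by rewrite /r -!mulrA.
  rewrite -!linearB; apply: Holder_L2_interpolation; rewrite ?mulr_gt0//.
    rewrite linearB; apply: le_trans (ler_normB _ _) _.
    by rewrite mulr2n mulrDl mul1r lerD// uM.
  rewrite !linearB/= -(subrKA (c i)) -(opprB _ (c i)).
  apply: le_trans (ler_normB _ _) _.
  by rewrite mulr2n mulrDl mul1r lerD.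
apply: (entropy_number_le _ _ _ _ _ _ b) => // x x1.
have [i xi] := cover _ x1; exists i.
by apply: bA; exists x; split.
Qed.
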